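(* Let $A \in \mathbb{R}^{n \times n}$ be symmetric positive definite and $x_0 = \mathbf{0}$. The discretized Ornstein-Uhlenbeck process $$x_{i+1} = (I - \Delta t A)x_i + \sqrt{2\Delta t}\, Z_i, \qquad Z_i \sim \mathcal{N}(0, I_n) \text{ independent},$$ produces iterative approximations to $A^{-1}$ via preconditioned gradient descent. Specifically, the covariance matrix $\Sigma_i = \mathbb{E}[x_i x_i^\top]$, which approximates $A^{-1}$, evolves according to $$\Sigma_{i+1} = \Sigma_i - 2\Delta t\,(\Sigma_i A - I) + O(\Delta t^2).$$ Upon neglecting quadratic terms of the time step, this update rule, i.e. $\Sigma_{i+1} = \Sigma_i - 2\Delta t\,(\Sigma_i A - I)$, is precisely preconditioned gradient descent minimizing $L(\Sigma) = \|\Sigma A - I\|_F^2$ with preconditioner $P = A$ and learning rate $\Delta t$.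
   Context: $I = I_n$ is the $n \times n$ identity matrix, $\|\cdot\|_F$ is the Frobenius norm, and $\Delta t$ is the time step. The process $(x_i)_{i \ge 0}$ is the Euler-Maruyama discretization, with time step $\Delta t$, of the Ornstein-Uhlenbeck equation $dX_t = -A X_t\,dt + \sqrt{2}\,dW_t$, where $W_t$ is a standard Wiener process in $\mathbb{R}^n$; $x_i$ approximates $X_{i\Delta t}$. Preconditioned gradient descent on $L$ with preconditioner $P$ and learning rate $\eta$ is the iteration $\Sigma_{i+1} = \Sigma_i - \eta P^{-1}\nabla L(\Sigma_i)$, where $\nabla L$ is the gradient of $L$ with respect to the matrix $\Sigma$. *)

(* Defs.v *)
From HB Require Import structures.
From mathcomp Require Import all_boot all_order all_algebra.
From mathcomp Require Import all_classical all_reals all_analysis.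
Set Implicit Arguments.
Unset Strict Implicit.
Unset Printing Implicit Defensive.
Import Order.TTheory GRing.Theory Num.Theory.
Import numFieldNormedType.Exports.
Local Open Scope classical_set_scope.
Local Open Scope ring_scope.

Definition sym_posdef (R : realType) (n : nat) (A : 'M[R]_n) : Prop :=
  A^T = A /\ (forall v : 'cV[R]_n, v != 0 -> 0 < (v^T *m A *m v) ord0 ord0).

Definition frobenius (R : realType) (m n : nat) (M : 'M[R]_(m, n)) : R :=
  Num.sqrt (\sum_i \sum_j M i j ^+ 2).

Definition borel_vec (R : realType) (n : nat) : set_system 'cV[R]_n :=
  <<s [set U | open U] >>.

Definition random_vector (R : realType) (n : nat) (d : measure_display)
    (T : measurableType d) (X : T -> 'cV[R]_n) : Prop :=
  forall B, borel_vec B -> measurable (X @^-1` B).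

(* The law of X on R^n is the n-fold product of N(0, 1), characterized by its
   values on measurable boxes. *)
Definition std_normal_vector (R : realType) (n : nat) (d : measure_display)
    (T : measurableType d) (P : probability T R) (X : T -> 'cV[R]_n) : Prop :=
  random_vector X /\
  forall B : 'I_n -> set R, (forall j, measurable (B j)) ->
    P [set w | forall j, B j (X w j ord0)] =
    (\prod_(j < n) normal_prob 0 1 (B j))%E.

Definition mutually_independent (R : realType) (n : nat) (d : measure_display)
    (T : measurableType d) (P : probability T R)
    (X : nat -> T -> 'cV[R]_n) : Prop :=
  forall (J : seq nat) (B : nat -> set 'cV[R]_n),
    uniq J -> (forall i, borel_vec (B i)) ->
    P (\bigcap_(i in [set` J]) (X i @^-1` B i)) =
    (\prod_(i <- J) P (X i @^-1` B i))%E.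

Definition std_gaussian_noise (R : realType) (n : nat) (d : measure_display)
    (T : measurableType d) (P : probability T R)
    (Z : nat -> T -> 'cV[R]_n) : Prop :=
  (forall i, std_normal_vector P (Z i)) /\ mutually_independent P Z.

Fixpoint ou_euler (R : realType) (n : nat) (T : Type) (A : 'M[R]_n) (dt : R)
    (x0 : 'cV[R]_n) (Z : nat -> T -> 'cV[R]_n) (i : nat) (w : T) : 'cV[R]_n :=
  if i is k.+1 then
    (1%:M - dt *: A) *m ou_euler A dt x0 Z k w + Num.sqrt (2 * dt) *: Z k w
  else x0.

Definition second_moment (R : realType) (n : nat) (d : measure_display)
    (T : measurableType d) (P : probability T R) (X : T -> 'cV[R]_n) : 'M[R]_n :=
  \matrix_(j, k) fine ('E_P[fun w => (X w *m (X w)^T) j k])%E.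

Definition ou_cov (R : realType) (n : nat) (d : measure_display)
    (T : measurableType d) (P : probability T R) (A : 'M[R]_n)
    (Z : nat -> T -> 'cV[R]_n) (dt : R) (i : nat) : 'M[R]_n :=
  second_moment P (ou_euler A dt 0 Z i).

Definition linear_update (R : realType) (n : nat) (A : 'M[R]_n) (dt : R)
    (S : 'M[R]_n) : 'M[R]_n :=
  S - (2 * dt) *: (S *m A - 1%:M).

Definition inv_loss (R : realType) (n : nat) (A S : 'M[R]_n) : R :=
  frobenius (S *m A - 1%:M) ^+ 2.

Definition mx_gradient (R : realType) (m n : nat) (L : 'M[R]_(m, n) -> R)
    (S : 'M[R]_(m, n)) : 'M[R]_(m, n) :=
  \matrix_(i, j) 'D_(delta_mx i j) L S.

(* Invertibility and differentiability are required because invmx and 'D_ are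
   total functions with meaningless values outside their natural domains. *)
Definition is_pgd_step (R : realType) (n : nat) (P : 'M[R]_n) (eta : R)
    (L : 'M[R]_n -> R) (S S' : 'M[R]_n) : Prop :=
  [/\ P \in unitmx, differentiable L S
    & S' = S - eta *: (invmx P *m mx_gradient L S)].

(* Main.v *)
Require Import Defs.
From HB Require Import structures.
From mathcomp Require Import all_boot all_order all_algebra.
From mathcomp Require Import all_classical all_reals all_analysis.
From mathcomp Require Import measurable_realfun ring lra.
Set Implicit Arguments.
Unset Strict Implicit.
Unset Printing Implicit Defensive.
Import Order.TTheory GRing.Theory Num.Theory.
Import numFieldNormedType.Exports.
Local Open Scope classical_set_scope.
Local Open Scope ring_scope.

(** Write [B = 1 - dt A].  The iterate [x_i] is a linear function of the noise
    vectors [Z_0, ..., Z_(i-1)], whose coordinates form an orthonormal family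
    of L2: each is N(0, 1), and any two of them are independent
    ([gaussian_noise_orthonormal]).  Expanding [E[x_i x_i^T]] in this family
    gives the exact recursion [S_(i+1) = B S_i B + 2 dt] with [S_0 = 0]
    ([ou_cov0], [ou_covS]).  Everything else is deterministic.

    - [S_i] is a polynomial in [A], so it commutes with [A]
      ([covariance_comm]), and expanding the recursion leaves exactly
      [dt^2 A S_i A] beyond the linear update ([covariance_remainder]).
    - [A] is coercive: [<X, A X> >= m |X|^2] for some [m > 0]
      ([posdef_coercive]).  Hence, for small [dt], [X |-> B X B] contracts the
      Frobenius norm by the factor [1 - dt m] ([euler_contraction]).  Then
      [S_i] is bounded independently of [i] and [dt]
      ([covariance_bounded]), which makes the remainder O(dt^2).
    - The error [E_i = S_i - A^-1] satisfies [E_(i+1) = B E_i B + dt^2 A]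
      ([covariance_error]), so it is at most a geometrically decaying term
      plus a multiple of [dt] ([covariance_error_le]).
    - The gradient of [|S A - 1|^2] is [2 (S A - 1) A^T]
      ([gradient_inv_loss]).  A preconditioned step therefore moves along
      [A^-1 (S A - 1) A], which is [S A - 1] because [S] commutes with [A]
      ([is_pgd_step_inv_loss]).  This commutation is inherited along the
      iteration from [S_0 = 0].

    The analytic input is that N(0, 1) has mean 0 and second moment 1; the
    second moment comes from the antiderivative [- x phi(x)] of
    [(x^2 - 1) phi(x)], where [phi] is the density. *)

(** * The Frobenius norm *)

(** The discriminant argument; when [b u u = 0] the quadratic polynomial in
    [k] degenerates to an affine one, which is nonnegative only if it is
    constant. *)
Lemma psd_cauchy_schwarz (R : realType) (V : lmodType R) (b : V -> V -> R)
    (bC : forall u v, b u v = b v u)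
    (bl : forall k u v w, b (k *: u + v) w = k * b u w + b v w)
    (b_ge0 : forall u, 0 <= b u u) (u v : V) :
  b u v ^+ 2 <= b u u * b v v.
Proof.
have br k x y w : b w (k *: x + y) = k * b w x + b w y by rewrite bC bl !(bC w).
have quad k : 0 <= k ^+ 2 * b u u + 2 * k * b u v + b v v.
  have := b_ge0 (k *: u + v); rewrite bl !br (bC v u); congr (_ <= _); ring.
have [buu0|buu0] := eqVneq (b u u) 0.
  rewrite buu0 mul0r.
  have [->|buv0] := eqVneq (b u v) 0; first by rewrite expr0n.
  (* any k with 2 k (b u v) < - b v v contradicts quad *)
  have := quad (- (b v v + 1) / b u v); rewrite buu0 mulr0 add0r mulrA divfK//.
  by have := b_ge0 v; lra.
have buu : 0 < b u u by rewrite lt_def buu0 b_ge0.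
(* the minimizer of the quadratic polynomial *)
have := quad (- b u v / b u u) => h.
rewrite -subr_ge0 (_ : _ - _ = b u u * ((- b u v / b u u) ^+ 2 * b u u +
  2 * (- b u v / b u u) * b u v + b v v)); last by field.
by rewrite mulr_ge0.
Qed.

Definition mxdot (R : realType) (m n : nat) (X Y : 'M[R]_(m, n)) : R :=
  \tr (X^T *m Y).

Section mxdot.
Context {R : realType}.

Lemma mxdotC m n (X Y : 'M[R]_(m, n)) : mxdot X Y = mxdot Y X.
Proof. by rewrite /mxdot -mxtrace_tr trmx_mul trmxK. Qed.

Lemma mxdot_linear m n k (X Y Z : 'M[R]_(m, n)) :
  mxdot (k *: X + Y) Z = k * mxdot X Z + mxdot Y Z.
Proof.
by rewrite /mxdot !linearD !linearZ/= mulmxDl linearD/= -scalemxAl linearZ.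
Qed.

Lemma mxdot_linearr m n k (X Y Z : 'M[R]_(m, n)) :
  mxdot Z (k *: X + Y) = k * mxdot Z X + mxdot Z Y.
Proof. by rewrite mxdotC mxdot_linear !(mxdotC _ Z). Qed.

Lemma mxdotE m n (X Y : 'M[R]_(m, n)) :
  mxdot X Y = \sum_i \sum_j X i j * Y i j.
Proof.
rewrite exchange_big; apply: eq_bigr => j _; rewrite mxE.
by apply: eq_bigr => i _; rewrite mxE.
Qed.

Lemma mxdot_ge0 m n (X : 'M[R]_(m, n)) : 0 <= mxdot X X.
Proof.
by rewrite mxdotE; do 2!(apply: sumr_ge0 => ? _); rewrite -expr2 sqr_ge0.
Qed.

Lemma mxdot_mull m n p (A : 'M[R]_(m, n)) (X : 'M[R]_(n, p)) Y :
  mxdot (A *m X) Y = mxdot X (A^T *m Y).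
Proof. by rewrite /mxdot trmx_mul mulmxA. Qed.

Lemma sqr_frobenius m n (X : 'M[R]_(m, n)) : frobenius X ^+ 2 = mxdot X X.
Proof.
rewrite sqr_sqrtr ?mxdotE//.
by do 2!(apply: sumr_ge0 => ? _); rewrite sqr_ge0.
Qed.

Lemma frobenius_ge0 m n (X : 'M[R]_(m, n)) : 0 <= frobenius X.
Proof. exact: sqrtr_ge0. Qed.

Lemma frobeniusN m n (X : 'M[R]_(m, n)) : frobenius (- X) = frobenius X.
Proof.
by congr Num.sqrt; do 2!(apply: eq_bigr => ? _); rewrite mxE sqrrN.
Qed.

Lemma frobenius_trmx m n (X : 'M[R]_(m, n)) : frobenius X^T = frobenius X.
Proof.
congr Num.sqrt; rewrite exchange_big.
by do 2!(apply: eq_bigr => ? _); rewrite mxE.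
Qed.

Lemma frobenius0 m n : frobenius (0 : 'M[R]_(m, n)) = 0.
Proof.
rewrite /frobenius big1 ?sqrtr0// => i _; rewrite big1// => j _.
by rewrite mxE expr0n.
Qed.

Lemma frobeniusZ m n k (X : 'M[R]_(m, n)) :
  frobenius (k *: X) = `|k| * frobenius X.
Proof.
rewrite /frobenius -sqrtr_sqr -sqrtrM ?sqr_ge0//; congr Num.sqrt.
rewrite mulr_sumr; apply: eq_bigr => i _; rewrite mulr_sumr.
by apply: eq_bigr => j _; rewrite mxE exprMn.
Qed.

Lemma mxdot_le m n (X Y : 'M[R]_(m, n)) :
  mxdot X Y <= frobenius X * frobenius Y.
Proof.
have := @psd_cauchy_schwarz R _ (@mxdot R m n) (@mxdotC _ _)
  (@mxdot_linear _ _) (@mxdot_ge0 _ _) X Y.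
rewrite -!sqr_frobenius -exprMn => h.
rewrite (le_trans (ler_norm _))// -ler_sqr ?nnegrE ?mulr_ge0 ?frobenius_ge0//.
by rewrite real_normK ?num_real.
Qed.

Lemma ler_frobeniusD m n (X Y : 'M[R]_(m, n)) :
  frobenius (X + Y) <= frobenius X + frobenius Y.
Proof.
rewrite -ler_sqr ?nnegrE ?addr_ge0 ?frobenius_ge0// sqrrD !sqr_frobenius.
have e Z : mxdot (X + Y) Z = mxdot X Z + mxdot Y Z.
  by rewrite -[in LHS](scale1r X) mxdot_linear mul1r.
by rewrite e !(mxdotC _ (X + Y)) !e (mxdotC Y X); have := mxdot_le X Y; lra.
Qed.

(** Each entry of the product is bounded by Cauchy-Schwarz applied to a row of
    [X] and a column of [Y]. *)
Lemma ler_frobeniusM m n p (X : 'M[R]_(m, n)) (Y : 'M[R]_(n, p)) :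
  frobenius (X *m Y) <= frobenius X * frobenius Y.
Proof.
rewrite -ler_sqr ?nnegrE ?mulr_ge0 ?frobenius_ge0// exprMn !sqr_frobenius.
rewrite (mxdotE (X *m Y)) (mxdotE X) big_distrl/=.
apply: ler_sum => i _.
rewrite (mxdotE Y) exchange_big/= big_distrr/=; apply: ler_sum => j _.
have -> : (X *m Y) i j = mxdot (row i X)^T (col j Y).
  by rewrite mxdotE mxE; apply: eq_bigr => k _; rewrite big_ord1 !mxE.
have := @psd_cauchy_schwarz R _ (@mxdot R n 1) (@mxdotC _ _)
  (@mxdot_linear _ _) (@mxdot_ge0 _ _) (row i X)^T (col j Y).
rewrite -expr2; congr (_ <= _ * _); rewrite mxdotE; apply: eq_bigr => k _;
  by rewrite big_ord1 !mxE.
Qed.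

End mxdot.

(** * Positive definite matrices and contraction of the Euler step *)

Section posdef.
Context {R : realType} {n : nat} {A : 'M[R]_n} (posA : sym_posdef A).

Lemma sym_posdef_unitmx : A \in unitmx.
Proof.
rewrite -row_free_unit -kermx_eq0; apply/eqP/row_matrixP => i; rewrite row0.
apply/eqP; apply: contraT => ri0.
have := posA.2 (row i (kermx A))^T.
rewrite trmxK -(inj_eq trmx_inj) trmx0 trmxK => /(_ ri0).
by rewrite -row_mul mulmx_ker row0 mul0mx mxE ltxx.
Qed.

Lemma mxdot_posdef_ge0 (X : 'M[R]_n) : 0 <= mxdot X (A *m X).
Proof.
apply: sumr_ge0 => j _.
have -> : (X^T *m (A *m X)) j j = ((col j X)^T *m A *m col j X) ord0 ord0.
  rewrite tr_col !mulmxA -row_mul !mxE; apply: eq_bigr => k _.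
  by rewrite !mxE.
have [->|Xj0] := eqVneq (col j X) 0; first by rewrite mulmx0 mxE.
exact/ltW/posA.2.
Qed.

(** Cauchy-Schwarz for the form [(X, Y) |-> <X, A Y>] at [Y = A^-1 X] gives
    [|X|^4 <= <X, A X> <A^-1 X, X>]: a coercivity constant [1 / |A^-1|] without
    eigenvalues or compactness. *)
Lemma posdef_coercive (X : 'M[R]_n) :
  frobenius X ^+ 2 <= frobenius (invmx A) * mxdot X (A *m X).
Proof.
have uA := sym_posdef_unitmx.
pose b (U V : 'M[R]_n) := mxdot U (A *m V).
have bC U V : b U V = b V U by rewrite /b mxdotC mxdot_mull posA.1.
have bl k U V W : b (k *: U + V) W = k * b U W + b V W by exact: mxdot_linear.
have := @psd_cauchy_schwarz R _ b bC bl mxdot_posdef_ge0 X (invmx A *m X).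
rewrite /b !mulKVmx// -sqr_frobenius => h.
have h2 : mxdot (invmx A *m X) X <= frobenius (invmx A) * frobenius X ^+ 2.
  rewrite (le_trans (mxdot_le _ _))// expr2 mulrA ler_wpM2r ?frobenius_ge0//.
  exact: ler_frobeniusM.
have [->|X0] := eqVneq (frobenius X) 0.
  by rewrite expr0n mulr_ge0 ?frobenius_ge0 ?mxdot_posdef_ge0.
have X2 : 0 < frobenius X ^+ 2 by rewrite exprn_gt0// lt_def X0 frobenius_ge0.
rewrite -(ler_pM2r X2) -expr2 (le_trans h)// mulrAC mulrC.
by rewrite ler_wpM2r ?mxdot_posdef_ge0.
Qed.

(** Expanding [|B Y|^2 = |Y|^2 - 2 dt <Y, A Y> + dt^2 |A Y|^2], coercivity makes
    the middle term at most [- 2 dt m |Y|^2], and for small [dt] the last one is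
    at most [dt m |Y|^2]; so [|B Y|^2 <= (1 - dt m) |Y|^2].  Multiplying by [B]
    on both sides uses this bound twice. *)
Lemma euler_contraction : exists m : R, 0 < m /\ \forall dt \near 0^'+,
  [/\ 0 < dt, dt * m < 1 & forall X : 'M[R]_n,
    frobenius ((1%:M - dt *: A) *m X *m (1%:M - dt *: A)) <=
    (1 - dt * m) * frobenius X].
Proof.
(* adding 1 keeps both constants positive, also in dimension 0 *)
pose K := frobenius (invmx A) + 1; pose a := frobenius A ^+ 2 + 1.
have K0 : 0 < K by rewrite ltr_wpDl ?frobenius_ge0.
have a0 : 0 < a by rewrite ltr_wpDl ?sqr_ge0.
exists K^-1; split; first by rewrite invr_gt0.
near=> dt.
have dt0 : 0 < dt by near: dt; exact: nbhs_right_gt.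
have dtK : dt * K^-1 < 1.
  rewrite ltr_pdivrMr// mul1r; near: dt; exact: nbhs_right_lt.
have dta : dt < K^-1 / a.
  by near: dt; apply: nbhs_right_lt; rewrite divr_gt0 ?invr_gt0.
split=> // X.
set B := 1%:M - dt *: A.
have BT : B^T = B by rewrite /B linearB/= linearZ/= trmx1 posA.1.
have contr (Y : 'M[R]_n) :
    frobenius (B *m Y) ^+ 2 <= (1 - dt * K^-1) * frobenius Y ^+ 2.
  have -> : frobenius (B *m Y) ^+ 2 = frobenius Y ^+ 2
      - 2 * dt * mxdot Y (A *m Y) + dt ^+ 2 * frobenius (A *m Y) ^+ 2.
    rewrite !sqr_frobenius /B mulmxBl mul1mx -scalemxAl -scaleNr addrC.
    rewrite mxdot_linear !mxdot_linearr (mxdotC (A *m Y) Y).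
    ring.
  have c1 : K^-1 * frobenius Y ^+ 2 <= mxdot Y (A *m Y).
    rewrite ler_pdivrMl// (le_trans (posdef_coercive Y))//.
    by rewrite ler_wpM2r ?mxdot_posdef_ge0// lerDl.
  have c2 : dt * frobenius (A *m Y) ^+ 2 <= K^-1 * frobenius Y ^+ 2.
    have : frobenius (A *m Y) ^+ 2 <= a * frobenius Y ^+ 2.
      apply: (@le_trans _ _ (frobenius A ^+ 2 * frobenius Y ^+ 2)).
        rewrite -exprMn ler_pXn2r ?nnegrE ?mulr_ge0 ?frobenius_ge0//.
        exact: ler_frobeniusM.
      by rewrite ler_wpM2r ?sqr_ge0// lerDl.
    move=> /(ler_wpM2l (ltW dt0)) /le_trans; apply; rewrite mulrA.
    by rewrite ler_wpM2r ?sqr_ge0// -ler_pdivlMr// ltW.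
  have := ler_wpM2l (ltW dt0) c1; have := ler_wpM2l (ltW dt0) c2.
  rewrite mulrA -expr2; lra.
have q0 : 0 <= 1 - dt * K^-1 by rewrite subr_ge0 ltW.
rewrite -ler_sqr ?nnegrE ?mulr_ge0 ?frobenius_ge0//.
rewrite -frobenius_trmx trmx_mul BT (le_trans (contr _))//.
rewrite exprMn [(1 - _) ^+ 2]expr2 -mulrA ler_wpM2l//.
by rewrite frobenius_trmx.
Unshelve. all: by end_near. Qed.

End posdef.
(** * The gradient of the loss *)

Section gradient.
Context {R : realType} {n : nat}.
Implicit Types A S E : 'M[R]_n.

(** The loss is a polynomial in the entries of [S]. *)
Lemma inv_loss_differentiable A S : differentiable (inv_loss A) S.
Proof.
have -> : inv_loss A = \sum_(i < n) \sum_(j < n)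
    (\sum_(k < n) (A k j *: (fun S : 'M[R]_n => S i k : R))
      - cst ((1%:M : 'M[R]_n) i j)) ^+ 2.
  apply/funext => X; rewrite /inv_loss sqr_frobenius mxdotE fct_sumE.
  apply: eq_bigr => i _; rewrite fct_sumE; apply: eq_bigr => j _.
  rewrite -expr2 !mxE !fctE; congr ((_ - _) ^+ 2).
  by rewrite fct_sumE; apply: eq_bigr => k _; rewrite mulrC.
do 2!(apply: differentiable_sum => ?).
apply/differentiableX/differentiableB; last exact: differentiable_cst.
by apply: differentiable_sum => k; exact/differentiableZ/differentiable_coord.
Qed.

(** The loss is quadratic along the line [S + h E], so the difference quotient
    is affine in [h]. *)
Lemma derive_inv_loss A S E :
  'D_E (inv_loss A) S = 2 * mxdot (S *m A - 1%:M) (E *m A).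
Proof.
set F := S *m A - 1%:M; set G := E *m A.
have expand h : inv_loss A (h *: E + S) - inv_loss A S =
    h * (2 * mxdot F G + h * mxdot G G).
  rewrite /inv_loss !sqr_frobenius mulmxDl -scalemxAl -addrA -/F -/G.
  rewrite mxdot_linear !mxdot_linearr (mxdotC G F); ring.
apply/cvg_lim => //.
have lim : (2 * mxdot F G + h * mxdot G G) @[h --> 0^'] --> 2 * mxdot F G.
  rewrite -[X in _ --> X]addr0; apply: cvgD; first exact: cvg_cst.
  rewrite -[X in _ --> X](mul0r (mxdot G G)); apply: cvgM; last exact: cvg_cst.
  exact: nbhs_dnbhs.
apply: cvg_trans lim; apply: near_eq_cvg; near=> h.
rewrite /= expand scalerA mulVf ?scale1r//.
by near: h; exact: nbhs_dnbhs_neq.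
Unshelve. all: by end_near. Qed.

(** The adjoint of [E |-> E A] is [F |-> F A^T]. *)
Lemma gradient_inv_loss A S :
  mx_gradient (inv_loss A) S = 2 *: ((S *m A - 1%:M) *m A^T).
Proof.
apply/matrixP => i j; rewrite mxE derive_inv_loss [in RHS]mxE; congr (_ * _).
set F := _ - _; rewrite /mxdot mulmxA mxtrace_mulC mulmxA.
have -> : A *m F^T = (F *m A^T)^T by rewrite trmx_mul trmxK.
rewrite -/(mxdot _ _) mxdotE (bigD1 i)//= (bigD1 j)//=.
rewrite [delta_mx _ _ _ _]mxE !eqxx mulr1.
rewrite !big1 ?addr0// => [k ki|k kj].
  by rewrite big1// => l _; rewrite [delta_mx _ _ _ _]mxE (negbTE ki) mulr0.
by rewrite [delta_mx _ _ _ _]mxE (negbTE kj) andbF mulr0.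
Qed.

(** Commutation is what makes the left preconditioner [A^-1] cancel the factor
    [A] that the gradient carries on the right. *)
Lemma is_pgd_step_inv_loss A dt S S' : sym_posdef A -> A *m S = S *m A ->
  is_pgd_step A dt (inv_loss A) S S' <-> S' = linear_update A dt S.
Proof.
move=> posA AS; have uA := sym_posdef_unitmx posA.
have -> : linear_update A dt S =
    S - dt *: (invmx A *m mx_gradient (inv_loss A) S).
  rewrite gradient_inv_loss posA.1 /linear_update -scalemxAr scalerA (mulrC dt).
  congr (S - _ *: _).
  have -> : (S *m A - 1%:M) *m A = A *m (S *m A - 1%:M).
    by rewrite mulmxBl mulmxBr mul1mx mulmx1 mulmxA AS.
  by rewrite mulKmx.
by split=> [[]|->]//; split=> //; exact: inv_loss_differentiable.
Qed.

Lemma linear_update_comm A dt S :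
  A *m S = S *m A -> A *m linear_update A dt S = linear_update A dt S *m A.
Proof.
move=> AS; rewrite /linear_update mulmxBl mulmxBr -scalemxAr -scalemxAl.
by rewrite mulmxBl mulmxBr mul1mx mulmx1 mulmxA AS.
Qed.

End gradient.
(** * Moments of the standard normal law *)

Section std_normal.
Context {R : realType}.
Notation mu := (@lebesgue_measure R).
Notation phi := (@normal_pdf R 0 1).
Local Open Scope ereal_scope.

(** The Radon-Nikodym derivative of the normal law with respect to Lebesgue
    measure is its density, up to a null set. *)
Lemma ge0_integral_normal_prob (m s : R) (f : R -> \bar R) :
  measurable_fun [set: R] f -> (forall x, 0 <= f x) ->
  \int[normal_prob m s]_x f x = \int[mu]_x (f x * (normal_pdf m s x)%:E).
Proof.
move=> mf f0.
have nmu := normal_prob_dominates m s.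
rewrite -(Radon_Nikodym_SigmaFinite.change_of_variables nmu)//.
have mrn : measurable_fun setT
    (Radon_Nikodym_SigmaFinite.f (normal_prob m s) mu).
  exact: measurable_int (Radon_Nikodym_SigmaFinite.f_integrable nmu).
have mpdf : measurable_fun setT (EFin \o normal_pdf m s).
  by apply/measurable_EFinP; exact: measurable_normal_pdf.
apply: ae_eq_integral => //; try exact: emeasurable_funM.
apply: ae_eqe_mul2l; apply: integral_ae_eq => //.
  exact: (Radon_Nikodym_SigmaFinite.f_integrable nmu).
by move=> E _ mE; rewrite -(Radon_Nikodym_SigmaFinite.f_integral nmu).
Qed.

Local Close Scope ereal_scope.

Lemma std_normal_pdfE x : phi x = normal_peak 1 * expR (- x ^+ 2 / 2).
Proof.
by rewrite normal_pdfE ?oner_eq0// /normal_fun subr0 expr1n.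
Qed.

Lemma is_derive_std_normal_pdf (x : R) : is_derive x 1 phi (- (x * phi x)).
Proof.
rewrite std_normal_pdfE.
rewrite (_ : phi = fun x => normal_peak 1 * expR (- x ^+ 2 / 2)).
  by apply: is_derive_eq; rewrite /GRing.scale/=; move: (expR _) => e; field.
by apply/funext => y; rewrite std_normal_pdfE.
Qed.

Lemma std_normal_pdfN (x : R) : phi (- x) = phi x.
Proof. by rewrite !std_normal_pdfE sqrrN. Qed.

(** Since [exp(y) >= y], [x exp(- x^2 / 2) <= 2 / x]. *)
Lemma cvg_mul_std_normal_pdf : (x * phi x) @[x --> +oo] --> 0.
Proof.
pose c : R := 2 * normal_peak 1.
have lim0 : c * x^-1 @[x --> +oo] --> 0.
  rewrite -(mulr0 c); apply: cvgM; first exact: cvg_cst.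
  by apply/gtr0_cvgV0; [near=> x|exact: cvg_id].
apply: (squeeze_cvgr _ (cvg_cst 0) lim0); near=> x.
have x0 : 0 < x by near: x; exact: nbhs_pinfty_gt.
rewrite mulr_ge0 ?normal_pdf_ge0 ?(ltW x0)//= std_normal_pdfE /c.
rewrite mulrCA (mulrC 2) -mulrA ler_wpM2l ?normal_peak_ge0//.
rewrite mulNr expRN ler_pdivrMr ?expR_gt0//.
apply: (@le_trans _ _ (2 / x * (x ^+ 2 / 2))).
  by rewrite le_eqVlt; apply/orP; left; apply/eqP; field; rewrite gt_eqF.
rewrite ler_wpM2l ?divr_ge0 ?(ltW x0)//.
by apply: le_trans (expR_ge1Dx _); rewrite lerDr.
Unshelve. all: by end_near. Qed.

Lemma continuous_std_normal_pdf : continuous phi.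
Proof. exact/continuous_normal_pdf/oner_neq0. Qed.

(* The antiderivative H of h = (x^2 - 1) phi compares the second moment with the
   total mass.  As h is negative on [0, 1[ and positive afterwards, the two
   ranges are treated separately. *)
Let H (x : R) : R := - (x * phi x).
Let h (x : R) : R := (x ^+ 2 - 1) * phi x.

Let is_derive_H (x : R) : is_derive x 1 H (h x).
Proof.
have := is_derive_std_normal_pdf x => dphi.
apply: is_derive_eq; rewrite /GRing.scale/= /h; ring.
Qed.

Let continuous_H : continuous H.
Proof.
move=> x; apply/differentiable_continuous/derivable1_diffP.
by case: (is_derive_H x).
Qed.

Let continuous_h : continuous h.
Proof.
move=> x; apply: cvgM; last exact: continuous_std_normal_pdf.
by apply: cvgB; [exact: exprn_continuous|exact: cvg_cst].
Qed.

Let derive1_H : H^`()%classic =1 h.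
Proof. by move=> x; rewrite derive1E; case: (is_derive_H x). Qed.

Let integral_h_tail :
  (\int[mu]_(x in `[1%R, +oo[) (h x)%:E = (phi 1)%:E)%E.
Proof.
rewrite (@ge0_continuous_FTC2y _ h H 1 0).
- by rewrite sub0e /H mul1r EFinN oppeK.
- move=> x x1; rewrite mulr_ge0 ?normal_pdf_ge0// subr_ge0 expr_ge1//.
  exact: le_trans x1.
- exact: continuous_subspaceT.
- by rewrite -oppr0; apply: cvgN; exact: cvg_mul_std_normal_pdf.
- by move=> x _; case: (is_derive_H x).
- exact/cvg_at_right_filter/continuous_H.
- by move=> x _; exact: derive1_H.
Qed.

Let integral_h_head :
  (\int[mu]_(x in `[0%R, 1%R]) (h x)%:E = - (phi 1)%:E)%E.
Proof.
rewrite (@continuous_FTC2 _ h H 0 1).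
- by rewrite /H mul0r oppr0 sube0 mul1r EFinN.
- exact: ltr01.
- exact: continuous_subspaceT.
- split.
  + by move=> x _; case: (is_derive_H x).
  + exact/cvg_at_right_filter/continuous_H.
  + exact/cvg_at_left_filter/continuous_H.
- by move=> x _; exact: derive1_H.
Qed.

Let measurable_sqr_phi : measurable_fun [set: R] (fun x => x ^+ 2 * phi x).
Proof.
apply: measurable_funM; first exact: measurable_funX.
exact: measurable_normal_pdf.
Qed.

Let measurable_h : measurable_fun [set: R] h.
Proof. exact: continuous_measurable_fun. Qed.

Let integral_half_sqr :
  (\int[mu]_(x in `[0%R, +oo[) (x ^+ 2 * phi x)%:E =
   \int[mu]_(x in `[0%R, +oo[) (phi x)%:E)%E.
Proof.
have split (f : R -> R) : measurable_fun [set: R] f ->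
    (\int[mu]_(x in `[0%R, +oo[) (f x)%:E =
     \int[mu]_(x in `[0%R, 1%R[) (f x)%:E +
     \int[mu]_(x in `[1%R, +oo[) (f x)%:E)%E.
  move=> mf.
  have -> : [set` `[0%R, +oo[] =
      [set` `[0%R, 1%R[] `|` [set` `[1%R, +oo[] :> set R.
    apply/seteqP; split=> x /=; rewrite !in_itv/= !andbT.
      by move=> x0; have [x1|x1] := ltP x 1; [left; rewrite x0|right].
    by case=> [/andP[]//|]; exact/le_trans/ler01.
  rewrite integral_setU//.
    exact/measurable_EFinP/measurable_funTS.
  apply/disj_set2P; rewrite -subset0 => x [] /=.
  by rewrite !in_itv/= andbT => /andP[_]; rewrite ltNge => /negP.
have mphi := measurable_normal_pdf 0 (1 : R).
rewrite !split//.
have tail : (\int[mu]_(x in `[1%R, +oo[) (x ^+ 2 * phi x)%:E =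
    (phi 1)%:E + \int[mu]_(x in `[1%R, +oo[) (phi x)%:E)%E.
  rewrite -integral_h_tail -ge0_integralD//=.
  - by apply: eq_integral => x _; rewrite -EFinD /h; congr EFin; ring.
  - move=> x; rewrite in_itv/= andbT => x1.
    rewrite lee_fin mulr_ge0 ?normal_pdf_ge0// subr_ge0 expr_ge1//.
    exact: le_trans x1.
  - exact/measurable_EFinP/measurable_funTS.
  - by move=> x _; rewrite lee_fin normal_pdf_ge0.
  - exact/measurable_EFinP/measurable_funTS.
have head : (\int[mu]_(x in `[0%R, 1%R[) (phi x)%:E =
    \int[mu]_(x in `[0%R, 1%R[) (x ^+ 2 * phi x)%:E + (phi 1)%:E)%E.
  rewrite !integral_itv_bndo_bndc; try exact/measurable_EFinP/measurable_funTS.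
  rewrite -[X in _ = _ + X]oppeK -integral_h_head -integralB_EFin//=.
  - by apply: eq_integral => x _; rewrite /h; congr EFin; ring.
  - apply: continuous_compact_integrable; first exact: segment_compact.
    apply: continuous_subspaceT => x.
    by apply: cvgM; [exact: exprn_continuous|exact: continuous_std_normal_pdf].
  - apply: continuous_compact_integrable; first exact: segment_compact.
    exact: continuous_subspaceT.
by rewrite tail head addeA.
Qed.

Lemma integral_sqr_std_normal :
  (\int[normal_prob 0 1]_x (x ^+ 2)%:E = 1 :> \bar R)%E.
Proof.
rewrite ge0_integral_normal_prob//; last 2 first.
- exact/measurable_EFinP/measurable_funX.
- by move=> x; rewrite lee_fin sqr_ge0.
under eq_integral do rewrite -EFinM.
rewrite ge0_symfun_integralT; last 3 first.
- by move=> x; rewrite mulr_ge0 ?sqr_ge0 ?normal_pdf_ge0.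
- move=> x.
  by apply: cvgM; [exact: exprn_continuous|exact: continuous_std_normal_pdf].
- by move=> x /=; rewrite sqrrN std_normal_pdfN.
rewrite -set_itvcy integral_half_sqr set_itvcy -ge0_symfun_integralT.
- exact: integral_normal_pdf.
- by move=> x; exact: normal_pdf_ge0.
- exact: continuous_std_normal_pdf.
- by move=> x /=; rewrite std_normal_pdfN.
Qed.

Lemma integrable_sqr_std_normal :
  (@normal_prob R 0 1).-integrable setT (fun x : R => (x ^+ 2)%:E).
Proof.
apply/integrableP; split; first exact/measurable_EFinP/measurable_funX.
under eq_integral do rewrite /= ger0_norm ?sqr_ge0//.
by rewrite integral_sqr_std_normal ltry.
Qed.

(** [|x| <= x^2 + 1]. *)
Lemma integrable_std_normal :
  (@normal_prob R 0 1).-integrable setT (EFin : R -> \bar R).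
Proof.
have i2 := integrableD measurableT integrable_sqr_std_normal
  (finite_measure_integrable_cst (@normal_prob R 0 1) 1 measurableT).
apply: le_integrable i2 => //= x _.
rewrite lee_fin [leRHS]ger0_norm ?addr_ge0 ?sqr_ge0//.
rewrite -(real_normK (num_real x)); have := sqr_ge0 (`|x| - 1); nra.
Qed.

(** Each half-line is the image of the other under [x |-> - x]. *)
Lemma ge0_integralT_opp (g : R -> R) : (forall x, 0 <= g x) -> continuous g ->
  (\int[mu]_x (g x)%:E = \int[mu]_x (g (- x))%:E)%E.
Proof.
move=> g0 cg.
have split (f : R -> R) : continuous f ->
    (\int[mu]_x (f x)%:E =
     \int[mu]_(x in `]-oo, 0%R]) (f x)%:E +
     \int[mu]_(x in `[0%R, +oo[) (f x)%:E)%E.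
  move=> /continuous_measurable_fun mf.
  rewrite -integral_itv_bndo_bndc; last exact/measurable_EFinP/measurable_funTS.
  rewrite -integral_setU//=.
  - congr (integral _ _ _); apply/seteqP; split=> // x _ /=.
    by rewrite !in_itv/= andbT; have [x0|x0] := ltP x 0; [left|right].
  - exact/measurable_EFinP/measurable_funTS.
  - apply/disj_set2P; rewrite -subset0 => x [] /=.
    by rewrite !in_itv/= andbT ltNge => /negP.
have half (f : R -> R) : (forall x, 0 <= f x) -> continuous f ->
    (\int[mu]_(x in `]-oo, 0%R]) (f x)%:E =
     \int[mu]_(x in `[0%R, +oo[) (f (- x))%:E)%E.
  move=> f0 cf; rewrite -{1}oppr0 ge0_integration_by_substitutionNy//.
  exact: continuous_subspaceT.
have cgN : continuous (fun x => g (- x)).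
  by move=> x; apply: continuous_comp; [exact: opp_continuous|exact: cg].
rewrite split// half// [RHS]split// half// addeC; congr (_ + _)%E.
by apply: eq_integral => x _; rewrite opprK.
Qed.

(** By symmetry of the density, the positive and the negative part of the
    identity have the same integral. *)
Lemma integral_std_normal : (\int[normal_prob 0 1]_x x%:E = 0 :> \bar R)%E.
Proof.
have fin := integrable_fin_num measurableT
  (integrable_funepos measurableT integrable_std_normal).
rewrite integralE.
suff -> : (\int[normal_prob 0 1]_x ((EFin : R -> \bar R)^\- x) =
    \int[normal_prob 0 1]_x ((EFin : R -> \bar R)^\+ x))%E by rewrite subee.
rewrite !ge0_integral_normal_prob//; last 2 first.
- exact: measurable_funepos.
- exact: measurable_funeneg.
have -> : (\int[mu]_x ((EFin : R -> \bar R)^\+ x * (phi x)%:E) =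
    \int[mu]_x (Num.max x 0 * phi x)%:E)%E.
  by apply: eq_integral => x _; rewrite funeposE -EFin_max EFinM.
rewrite ge0_integralT_opp; last 2 first.
- by move=> x; rewrite mulr_ge0 ?normal_pdf_ge0// le_max lexx orbT.
- move=> x; apply: cvgM; last exact: continuous_std_normal_pdf.
  by apply: continuous_max => //; exact: cvg_cst.
apply: eq_integral => x _.
by rewrite funenegE -EFinN -EFin_max std_normal_pdfN EFinM.
Qed.

End std_normal.
(** * Products of independent random variables *)

Section independent_product.
Context {R : realType} {d : measure_display} {T : measurableType d}
  (P : probability T R).
Variables m1 m2 : probability (measurableTypeR R) R.
Variables X Y : T -> measurableTypeR R.
Hypotheses (mX : measurable_fun [set: T] X) (mY : measurable_fun [set: T] Y).
Hypothesis indepXY : forall U V : set (measurableTypeR R),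
  measurable U -> measurable V ->
  P (X @^-1` U `&` Y @^-1` V) = (m1 U * m2 V)%E.
Hypotheses (i1 : m1.-integrable setT (EFin : R -> \bar R))
  (i2 : m2.-integrable setT (EFin : R -> \bar R)).
Local Open Scope ereal_scope.

Let XY w : measurableTypeR R * measurableTypeR R := (X w, Y w).

Let mXY : measurable_fun [set: T] XY.
Proof. exact: measurable_fun_pair. Qed.

Let mul2 (z : measurableTypeR R * measurableTypeR R) : \bar R := (z.1 * z.2)%:E.

Let measurable_mul2 : measurable_fun setT mul2.
Proof.
by apply/measurable_EFinP; apply: measurable_funM;
  [exact: measurable_fst|exact: measurable_snd].
Qed.

(* rectangles determine the joint law, so that Fubini applies to it *)
Let joint_law (A : set (measurableTypeR R * measurableTypeR R)) :
  measurable A -> pushforward P XY A = (m1 \x m2) A.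
Proof.
move=> mA; apply/esym.
pose XYm : {mfun T >-> (measurableTypeR R * measurableTypeR R)%type} :=
  HB.pack XY (isMeasurableFun.Build _ _ _ _ XY mXY).
exact: (@product_measure_unique _ _ _ _ R m1 m2 (distribution P XYm) indepXY).
Qed.

Let abs_moment (m : probability (measurableTypeR R) R) : \bar R :=
  \int[m]_y `|y%:E|.

Let integrable_mul2 : (m1 \x m2).-integrable setT mul2.
Proof.
apply/integrable12ltyP => //.
rewrite (_ : \int[m1]_x _ = \int[m1]_x (`|x%:E| * abs_moment m2)).
  rewrite ge0_integralZr//; last 2 first.
  - exact: measurableT_comp.
  - exact: integral_ge0.
  rewrite lte_mul_pinfty//; first exact: integral_ge0.
    by rewrite ge0_fin_numE ?integral_ge0//; have /integrableP[] := i1.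
  by have /integrableP[] := i2.
apply: eq_integral => x _; rewrite /abs_moment -ge0_integralZl//; last first.
  exact: measurableT_comp.
by apply: eq_integral => y _; rewrite -abseM.
Qed.

Lemma indep_integrable_mul : P.-integrable setT (fun w => (X w * Y w)%:E).
Proof.
apply/integrableP; split.
  exact/measurable_EFinP/measurable_funM.
have mabs := measurableT_comp (@abse_measurable R setT) measurable_mul2.
have := ge0_integral_pushforward mXY P measurableT mabs
  (fun _ _ => abse_ge0 _).
rewrite preimage_setT => <-.
rewrite (eq_measure_integral (m1 \x m2)); last first.
  by move=> A mA _; exact: joint_law.
by have /integrableP[] := integrable_mul2.
Qed.

Lemma indep_integral_mul :
  \int[P]_w (X w * Y w)%:E = \int[m1]_x x%:E * \int[m2]_y y%:E.
Proof.
have := integral_pushforward mXY measurable_mul2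
  indep_integrable_mul measurableT.
rewrite preimage_setT => <-.
rewrite (eq_measure_integral (m1 \x m2)); last first.
  by move=> A mA _; exact: joint_law.
rewrite -integral12_prod_meas1//.
have fin2 : \int[m2]_y y%:E \is a fin_num by exact: integrable_fin_num.
rewrite -[X in _ * X]fineK// -integralZr//; apply: eq_integral => x _.
by rewrite fineK// -integralZl.
Qed.

End independent_product.

(** * The coordinates of Gaussian noise *)

Section std_normal_coord.
Context {R : realType} {n : nat} {d : measure_display} {T : measurableType d}
  (P : probability T R).

Lemma borel_vec_coord (a : 'I_n) (U : set R) : measurable U ->
  borel_vec [set v : 'cV[R]_n | U (v a ord0)].
Proof.
move=> mU.
pose G := [set V : set 'cV[R]_n | open V].
pose coord (v : g_sigma_algebraType G) : R := (v : 'cV[R]_n) a ord0.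
suff : measurable_fun setT coord.
  by move=> /(_ measurableT _ mU); rewrite setTI.
apply: (measurability _ (RGenOpens.measurableE R)).
move=> _ [_ [x [y ->]] <-]; rewrite setTI; apply: sub_sigma_algebra.
move/continuousP : (@coord_continuous R n 1 a ord0); apply.
exact: interval_open.
Qed.

Lemma random_vector_coord (X : T -> 'cV[R]_n) a : random_vector X ->
  measurable_fun [set: T] (fun w => X w a ord0).
Proof.
by move=> mX _ U mU; rewrite setTI; exact: (mX _ (borel_vec_coord a mU)).
Qed.

(** Boxes whose sides other than [a] and [b] are the whole line. *)
Lemma std_normal_vector_coord2 (X : T -> 'cV[R]_n) (a b : 'I_n) (U V : set R) :
  std_normal_vector P X -> a != b -> measurable U -> measurable V ->
  P ((fun w => X w a ord0) @^-1` U `&` (fun w => X w b ord0) @^-1` V) =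
  (normal_prob 0 1 U * normal_prob 0 1 V)%E.
Proof.
move=> [_ law] ab mU mV.
pose B j := if j == a then U else if j == b then V else setT.
have mB j : measurable (B j) by rewrite /B; case: ifP => // _; case: ifP.
have := law _ mB; rewrite (bigD1 a)//= (bigD1 b)/= 1?eq_sym//.
rewrite big1 ?mule1; last first.
  by move=> j /andP[ja jb]; rewrite /B (negbTE ja) (negbTE jb) probability_setT.
rewrite /B !eqxx [b == a]eq_sym (negbTE ab) => <-; congr (P _).
apply/seteqP; split=> w /= => [[Uw Vw] j|Bw].
  by case: eqP => [->//|_]; case: eqP => [->//|_].
have := Bw a; have := Bw b.
by rewrite !eqxx [b == a]eq_sym (negbTE ab).
Qed.

Lemma std_normal_vector_coord (X : T -> 'cV[R]_n) (a : 'I_n) (U : set R) :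
  std_normal_vector P X -> measurable U ->
  P ((fun w => X w a ord0) @^-1` U) = normal_prob 0 1 U.
Proof.
move=> [_ law] mU.
pose B j := if j == a then U else setT.
have mB j : measurable (B j) by rewrite /B; case: ifP.
have := law _ mB; rewrite (bigD1 a)//= big1 ?mule1; last first.
  by move=> j ja; rewrite /B (negbTE ja) probability_setT.
rewrite /B eqxx => <-; congr (P _).
apply/seteqP; split=> w /= => [Uw j|Bw]; first by case: eqP => [->|].
by have := Bw a; rewrite eqxx.
Qed.

End std_normal_coord.
Section gaussian_noise.
Context {R : realType} {n : nat} {d : measure_display} {T : measurableType d}
  (P : probability T R).

Lemma std_normal_vector_sqr (X : T -> 'cV[R]_n) (a : 'I_n) :
  std_normal_vector P X ->
  (\int[P]_w (X w a ord0 ^+ 2)%:E = 1)%E.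
Proof.
move=> nX; pose Xa w : measurableTypeR R := X w a ord0.
have mXa : measurable_fun [set: T] Xa by exact: (random_vector_coord a nX.1).
rewrite -integral_sqr_std_normal.
rewrite (eq_measure_integral (pushforward P Xa)); last first.
  by move=> U mU _; apply/esym; exact: (std_normal_vector_coord a nX mU).
rewrite ge0_integral_pushforward//; first exact/measurable_EFinP/measurable_funX.
by move=> x _; rewrite lee_fin sqr_ge0.
Qed.

(** Two distinct coordinates are independent: by the product form of the law
    within one noise vector, by mutual independence across two of them. *)
Lemma gaussian_noise_orthonormal (Z : nat -> T -> 'cV[R]_n) l k (a b : 'I_n) :
  std_gaussian_noise P Z ->
  P.-integrable setT (fun w => (Z l w a ord0 * Z k w b ord0)%:E) /\
  (\int[P]_w (Z l w a ord0 * Z k w b ord0)%:E = ((l == k) && (a == b))%:R%:E)%E.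
Proof.
move=> [nZ indZ].
have mZ j c : measurable_fun [set: T] (fun w => Z j w c ord0).
  exact: (random_vector_coord c (nZ j).1).
have [/andP[/eqP <- /eqP <-]|lkab] := boolP ((l == k) && (a == b)).
  have e : (\int[P]_w (Z l w a ord0 * Z l w a ord0)%:E = 1)%E.
    exact: (std_normal_vector_sqr a (nZ l)).
  split=> //; apply/integrableP; split.
    exact/measurable_EFinP/measurable_funM.
  under eq_integral do rewrite /= ger0_norm -?expr2 ?sqr_ge0//.
  by rewrite (std_normal_vector_sqr a (nZ l)) ltry.
have indep (U V : set (measurableTypeR R)) : measurable U -> measurable V ->
    P ((fun w => Z l w a ord0) @^-1` U `&` (fun w => Z k w b ord0) @^-1` V) =
    (normal_prob 0 1 U * normal_prob 0 1 V)%E.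
  move=> mU mV; have [lk|lk] := eqVneq l k.
    move: lkab; rewrite lk eqxx /= => ab.
    exact: std_normal_vector_coord2 (nZ k) ab mU mV.
  pose B j := if j == l then [set v : 'cV[R]_n | U (v a ord0)]
              else [set v | V (v b ord0)].
  have lkU : uniq [:: l; k] by rewrite /= inE lk.
  have := indZ [:: l; k] B lkU; rewrite big_cons big_seq1 /B eqxx.
  rewrite eq_sym (negbTE lk) -(std_normal_vector_coord a (nZ l) mU).
  rewrite -(std_normal_vector_coord b (nZ k) mV) => <-; last first.
    by move=> j; case: ifP => _; exact: borel_vec_coord.
  congr (P _); apply/seteqP; split=> w /=.
    by move=> [Uw Vw] j /=; rewrite !inE => /orP[]/eqP ->;
      rewrite ?eqxx// eq_sym (negbTE lk).
  move=> h; split.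
    by have := h l; rewrite /= mem_head eqxx; exact.
  by have := h k; rewrite /= !inE eqxx orbT eq_sym (negbTE lk); exact.
split.
  exact: (indep_integrable_mul (mZ l a) (mZ k b) indep
    integrable_std_normal integrable_std_normal).
rewrite (indep_integral_mul (mZ l a) (mZ k b) indep
    integrable_std_normal integrable_std_normal).
by rewrite !integral_std_normal mule0.
Qed.

(** * The covariance of the discretized process *)

(** Bilinear expansion in the orthonormal family of noise coordinates, indexed
    by the pairs (time, coordinate). *)
Lemma second_moment_linear_noise (Z : nat -> T -> 'cV[R]_n) m i
    (M : nat -> 'M[R]_(m, n)) : std_gaussian_noise P Z ->
  second_moment P (fun w => \sum_(l < i) M l *m Z l w) =
  \sum_(l < i) M l *m (M l)^T.
Proof.
move=> noiseZ; apply/matrixP => j k; rewrite mxE unlock summxE.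
pose c j (p : 'I_i * 'I_n) := M p.1 j p.2.
pose z (p : 'I_i * 'I_n) w := Z p.1 w p.2 ord0.
have entry j' w : (\sum_(l < i) M l *m Z l w) j' ord0 = \sum_p c j' p * z p w.
  rewrite summxE (eq_bigr (fun l : 'I_i => \sum_a c j' (l, a) * z (l, a) w)).
    by rewrite pair_big; apply: eq_bigr => -[].
  by move=> l _; rewrite mxE.
rewrite (eq_integral (fun w => (\sum_p \sum_q
    ((c j p * c k q)%:E * (z p w * z q w)%:E))%E)); last first.
  move=> w _; rewrite mxE big_ord1 [in X in _ * X]mxE !entry big_distrl/=.
  rewrite -sumEFin; apply: eq_bigr => p _.
  rewrite big_distrr/= -sumEFin; apply: eq_bigr => q _.
  by rewrite -EFinM mulrACA.
have iz p q : P.-integrable setT (fun w => (z p w * z q w)%:E).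
  by have [] := gaussian_noise_orthonormal p.1 q.1 p.2 q.2 noiseZ.
have icz p q : P.-integrable setT
    (fun w => ((c j p * c k q)%:E * (z p w * z q w)%:E)%E).
  exact: integrableZl.
rewrite integral_sum//; last by move=> p; exact: integrable_sum.
rewrite (eq_bigr (fun p => (c j p * c k p)%:E)); last first.
  move=> p _; rewrite integral_sum// (bigD1 p)//= big1 ?adde0.
    rewrite integralZl//.
    have [_ ->] := gaussian_noise_orthonormal p.1 p.1 p.2 p.2 noiseZ.
    by rewrite !eqxx mule1.
  move=> q qp; rewrite integralZl//.
  have [_ ->] := gaussian_noise_orthonormal p.1 q.1 p.2 q.2 noiseZ.
  rewrite (_ : _ && _ = false) ?mule0//.
  apply: contra_neqF qp => /andP[/eqP e1 /eqP e2].
  by case: p q e1 e2 => [p1 p2] [q1 q2] /= /val_inj -> ->.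
rewrite sumEFin/= (eq_bigr (fun l : 'I_i => \sum_a c j (l, a) * c k (l, a))).
  by rewrite pair_big; apply: eq_bigr => -[].
by move=> l _; rewrite mxE; apply: eq_bigr => a _; rewrite mxE.
Qed.

(** The matrix by which [Z_l] enters [x_i]; it is [sqrt(2 dt) B^(i - 1 - l)] for
    [l < i]. *)
Fixpoint ou_response (A : 'M[R]_n) (dt : R) (i l : nat) : 'M[R]_n :=
  if i is k.+1 then
    if l == k then (Num.sqrt (2 * dt))%:M
    else (1%:M - dt *: A) *m ou_response A dt k l
  else 0.

Lemma ou_euler_response A dt (Z : nat -> T -> 'cV[R]_n) i w :
  ou_euler A dt 0 Z i w = \sum_(l < i) ou_response A dt i l *m Z l w.
Proof.
elim: i => [|i IH]/=; first by rewrite big_ord0.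
rewrite big_ord_recr/= eqxx mul_scalar_mx IH; congr (_ + _).
rewrite mulmx_sumr; apply: eq_bigr => l _.
by rewrite (ltn_eqF (ltn_ord l)) mulmxA.
Qed.

Lemma ou_cov0 A (Z : nat -> T -> 'cV[R]_n) dt : std_gaussian_noise P Z ->
  ou_cov P A Z dt 0 = 0.
Proof.
move=> noiseZ; rewrite /ou_cov (_ : ou_euler A dt 0 Z 0 =
  fun w => \sum_(l < 0) ou_response A dt 0 l *m Z l w).
  by rewrite second_moment_linear_noise// big_ord0.
by apply/funext => w; rewrite ou_euler_response.
Qed.

(** The noise [Z_i] is fresh, so it adds its own second moment [2 dt] without
    a cross term. *)
Lemma ou_covS A (Z : nat -> T -> 'cV[R]_n) dt i : std_gaussian_noise P Z ->
  0 <= dt ->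
  ou_cov P A Z dt i.+1 =
  (1%:M - dt *: A) *m ou_cov P A Z dt i *m (1%:M - dt *: A)^T + (2 * dt)%:M.
Proof.
move=> noiseZ dt0.
have covE j : ou_cov P A Z dt j =
    \sum_(l < j) ou_response A dt j l *m (ou_response A dt j l)^T.
  rewrite -(second_moment_linear_noise j (ou_response A dt j) noiseZ).
  by congr second_moment; apply/funext => w; rewrite ou_euler_response.
rewrite !covE big_ord_recr/= eqxx tr_scalar_mx -scalar_mxM -expr2.
rewrite sqr_sqrtr ?mulr_ge0//; congr (_ + _).
rewrite mulmx_sumr mulmx_suml; apply: eq_bigr => l _.
by rewrite (ltn_eqF (ltn_ord l)) trmx_mul !mulmxA.
Qed.

End gaussian_noise.
(** * The deterministic covariance recursion *)

Section covariance_recursion.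
Context {R : realType} {n : nat} {A : 'M[R]_n}.
Context {dt : R} {B : 'M[R]_n} {S : nat -> 'M[R]_n}.
Hypotheses (defB : B = 1%:M - dt *: A) (S0 : S 0%N = 0).
Hypothesis SS : forall i, S i.+1 = B *m S i *m B + (2 * dt)%:M.

Let BE : B = - dt *: A + 1%:M.
Proof. by rewrite defB addrC scaleNr. Qed.

Lemma covariance_comm i : A *m S i = S i *m A.
Proof.
have AB : A *m B = B *m A.
  by rewrite BE mulmxDr mulmxDl -scalemxAr -scalemxAl mulmx1 mul1mx.
elim: i => [|i IH]; first by rewrite S0 mulmx0 mul0mx.
rewrite SS mulmxDr mulmxDl scalar_mxC; congr (_ + _).
by rewrite !mulmxA AB -(mulmxA B A) IH -!mulmxA AB.
Qed.

(** Expanding [(1 - dt A) S (1 - dt A)], commutation turns [A S + S A] into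
    [2 S A]. *)
Lemma covariance_remainder i :
  S i.+1 - linear_update A dt (S i) = dt ^+ 2 *: (A *m S i *m A).
Proof.
rewrite SS /linear_update BE -(scalemx1 _ (2 * dt)).
rewrite !mulmxDl !mulmxDr !mul1mx !mulmx1 -!scalemxAl -!scalemxAr.
rewrite covariance_comm scalerBr.
apply/matrixP => j k; rewrite !mxE; ring.
Qed.

Hypothesis unitA : A \in unitmx.

(** [A^-1] is a fixed point of the recursion up to [dt^2 A]. *)
Lemma covariance_error i :
  S i.+1 - invmx A = B *m (S i - invmx A) *m B + dt ^+ 2 *: A.
Proof.
have BAB : B *m invmx A *m B =
    invmx A - ((2 * dt) *: 1%:M : 'M[R]_n) + dt ^+ 2 *: A.
  rewrite BE !mulmxDl !mulmxDr !mul1mx !mulmx1 -!scalemxAl -!scalemxAr.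
  rewrite mulmxV// mulVmx// mul1mx.
  apply/matrixP => j k; rewrite !mxE; ring.
rewrite mulmxBr mulmxBl BAB SS scalemx1.
by apply/matrixP => j k; rewrite !mxE; ring.
Qed.

Variable m : R.
Hypotheses (m0 : 0 < m) (dt0 : 0 < dt) (dtm : dt * m < 1).
Hypothesis contraction : forall X : 'M[R]_n,
  frobenius (B *m X *m B) <= (1 - dt * m) * frobenius X.

(** The bound [K] is the fixed point of [x |-> (1 - dt m) x + 2 dt |1|]; the
    time step cancels in it. *)
Lemma covariance_bounded i :
  frobenius (S i) <= 2 * frobenius (1%:M : 'M[R]_n) / m.
Proof.
set K := _ / m.
have K0 : 0 <= K by rewrite divr_ge0 ?(ltW m0)// mulr_ge0// frobenius_ge0.
have dt2 : frobenius ((2 * dt)%:M : 'M[R]_n) = dt * m * K.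
  rewrite -scalemx1 frobeniusZ ger0_norm ?mulr_ge0 ?(ltW dt0)// /K.
  by field; rewrite gt_eqF.
elim: i => [|i IH]; first by rewrite S0 frobenius0.
rewrite SS (le_trans (ler_frobeniusD _ _))// dt2.
have := contraction (S i).
have : (1 - dt * m) * frobenius (S i) <= (1 - dt * m) * K.
  by rewrite ler_wpM2l// subr_ge0 ltW.
lra.
Qed.

(** Again [dt |A| / m] is the fixed point of [x |-> (1 - dt m) x + dt^2 |A|]. *)
Lemma covariance_error_le i :
  frobenius (S i - invmx A) <=
  (1 - dt * m) ^+ i * frobenius (invmx A) + dt * (frobenius A / m).
Proof.
elim: i => [|i IH].
  rewrite S0 sub0r frobeniusN expr0 mul1r lerDl mulr_ge0 ?(ltW dt0)//.
  by rewrite divr_ge0 ?frobenius_ge0 ?(ltW m0).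
rewrite covariance_error (le_trans (ler_frobeniusD _ _))// frobeniusZ.
rewrite ger0_norm ?sqr_ge0//.
have -> : dt ^+ 2 * frobenius A = dt * m * (dt * (frobenius A / m)).
  by field; rewrite gt_eqF.
have := contraction (S i - invmx A).
have : (1 - dt * m) * frobenius (S i - invmx A) <= (1 - dt * m) *
    ((1 - dt * m) ^+ i * frobenius (invmx A) + dt * (frobenius A / m)).
  by rewrite ler_wpM2l// subr_ge0 ltW.
rewrite exprS; lra.
Qed.

End covariance_recursion.

(** * The Euler scheme as preconditioned gradient descent *)

Theorem theorem0p1 (R : realType) (n : nat) (A : 'M[R]_n)
    (posA : sym_posdef A) :
  (* evolution of the covariance, with an O(dt^2) constant depending only on A *)
  (exists C : R, \forall dt \near 0^'+,
     forall (d : measure_display) (T : measurableType d) (P : probability T R)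
       (Z : nat -> T -> 'cV[R]_n), std_gaussian_noise P Z ->
     forall i : nat,
       frobenius (ou_cov P A Z dt i.+1 - linear_update A dt (ou_cov P A Z dt i))
         <= C * dt ^+ 2)
  /\
  (* the covariance approximates the inverse of A *)
  (forall eps : R, 0 < eps -> \forall dt \near 0^'+,
     forall (d : measure_display) (T : measurableType d) (P : probability T R)
       (Z : nat -> T -> 'cV[R]_n), std_gaussian_noise P Z ->
     \forall i \near \oo, frobenius (ou_cov P A Z dt i - invmx A) < eps)
  /\
  (* the linearized update, applied to the covariances, is a step of
     preconditioned gradient descent *)
  (forall (dt : R), 0 < dt ->
     forall (d : measure_display) (T : measurableType d) (P : probability T R)
       (Z : nat -> T -> 'cV[R]_n), std_gaussian_noise P Z ->
     forall i : nat,
       is_pgd_step A dt (inv_loss A) (ou_cov P A Z dt i)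
         (linear_update A dt (ou_cov P A Z dt i)))
  /\
  (* the iteration of the linearized update from the covariance 0 of x_0 is
     preconditioned gradient descent *)
  (forall (dt : R), 0 < dt ->
     forall S : nat -> 'M[R]_n, S 0%N = 0 ->
     (forall i, S i.+1 = linear_update A dt (S i)) <->
     (forall i, is_pgd_step A dt (inv_loss A) (S i) (S i.+1))).
Proof.
have uA := sym_posdef_unitmx posA.
have covS (dt : R) (d : measure_display) (T : measurableType d)
    (P : probability T R) (Z : nat -> T -> 'cV[R]_n) : 0 < dt ->
    std_gaussian_noise P Z -> forall i, ou_cov P A Z dt i.+1 =
    (1%:M - dt *: A) *m ou_cov P A Z dt i *m (1%:M - dt *: A) + (2 * dt)%:M.
  move=> dt0 noiseZ i; rewrite (ou_covS A i noiseZ (ltW dt0)).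
  have -> // : (1%:M - dt *: A)^T = 1%:M - dt *: A.
  by rewrite linearB/= linearZ/= trmx1 posA.1.
have [m [m0 contr]] := euler_contraction posA.
split; [|split; [|split]].
- exists (frobenius A ^+ 2 * (2 * frobenius (1%:M : 'M[R]_n) / m)).
  apply: filterS contr => dt [dt0 dtm dtc] d T P Z noiseZ i.
  have cov0 := ou_cov0 A dt noiseZ.
  have recur := covS _ _ _ _ _ dt0 noiseZ.
  have bound := covariance_bounded cov0 recur m0 dt0 dtm dtc i.
  rewrite (covariance_remainder erefl cov0 recur).
  rewrite frobeniusZ ger0_norm ?sqr_ge0// mulrC ler_wpM2r ?sqr_ge0//.
  rewrite (le_trans (ler_frobeniusM _ _))// expr2 mulrAC.
  rewrite ler_wpM2r ?frobenius_ge0// (le_trans (ler_frobeniusM _ _))//.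
  by rewrite ler_wpM2l ?frobenius_ge0.
- move=> eps eps0.
  (* half of eps for the bias of order dt, half for the geometric term *)
  have small : \forall dt \near 0^'+, dt * (frobenius A / m + 1) < eps / 2.
    have k0 : 0 < frobenius A / m + 1.
      by rewrite ltr_wpDl// divr_ge0 ?frobenius_ge0 ?(ltW m0).
    near=> dt; rewrite -ltr_pdivlMr//; near: dt; apply: nbhs_right_lt.
    by apply: divr_gt0 k0; rewrite divr_gt0.
  apply: filterS2 contr small => dt [dt0 dtm dtc] bias d T P Z noiseZ.
  have cov0 := ou_cov0 A dt noiseZ.
  have recur := covS _ _ _ _ _ dt0 noiseZ.
  have decay : (1 - dt * m) ^+ i * frobenius (invmx A) @[i --> \oo] --> 0.
    rewrite -(mul0r (frobenius (invmx A))); apply: cvgM; last exact: cvg_cst.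
    apply: cvg_expr; rewrite ger0_norm ?subr_ge0 ?(ltW dtm)//.
    by rewrite gtrBl mulr_gt0.
  near=> i.
  have err := covariance_error_le erefl cov0 recur uA m0 dt0 dtm dtc i.
  have : (1 - dt * m) ^+ i * frobenius (invmx A) < eps / 2.
    by near: i; apply: (cvgr_lt 0 decay); rewrite divr_gt0.
  lra.
- move=> dt dt0 d T P Z noiseZ i; apply/is_pgd_step_inv_loss => //.
  exact: (covariance_comm erefl (ou_cov0 A dt noiseZ)
    (covS _ _ _ _ _ dt0 noiseZ)).
- (* in either direction commutation with A propagates along the iteration *)
  move=> dt dt0 S S0; split=> h.
    have comm i : A *m S i = S i *m A.
      elim: i => [|i IH]; first by rewrite S0 mulmx0 mul0mx.
      by rewrite h linear_update_comm.
    by move=> i; apply/is_pgd_step_inv_loss.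
  have comm i : A *m S i = S i *m A.
    elim: i => [|i IH]; first by rewrite S0 mulmx0 mul0mx.
    have /(is_pgd_step_inv_loss _ _ posA IH) -> := h i.
    by rewrite linear_update_comm.
  by move=> i; apply/is_pgd_step_inv_loss.
Unshelve. all: by end_near. Qed.
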